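(* Let $V=\mathbb{C}^m$ be equipped with a non-degenerate symmetric bilinear form $(\;,\;)$ and let $G=\mathrm{O}(V)$ be its isometry group. Assume that for some integer $r_c>0$ there exists a harmonic element $\Lambda\in (V^{\otimes r_c})^{G,\det}$ satisfying $(\Lambda,\Lambda)\neq 0$. Then, for any integer $r\ge 0$, $(V^{\otimes r})^{G,\det}\neq 0$ if and only if $r-r_c\geq 0$ and $r-r_c$ is even, and in this case $$(V^{\otimes r})^{G,\det}=\mathbb{C}\,\mathrm{Sym}_r\left(\Lambda\otimes \check{C}^{\otimes \frac{r-r_c}{2}}\right).$$
   Context: For a finite dimensional $G$-module $M$, $M^{G,\det}=\{x\in M\mid g(x)=\det(g)x \text{ for all } g\in G\}$. The group $G$ acts diagonally on $V^{\otimes r}$ (with $V^{\otimes 0}=\mathbb{C}$ the trivial module). The form on $V$ extends to a non-degenerate symmetric bilinear form, also denoted $(\;,\;)$, on $V^{\otimes r}$ by $(v_1\otimes\dots\otimes v_r,w_1\otimes\dots\otimes w_r)=\prod_i (v_i,w_i)$. If $e_1,\dots,e_m$ is an orthonormal basis of $V$, then $\check C:=\sum_{i=1}^m e_i\otimes e_i\in V\otimes V$ (independent of the orthonormal basis), and $\hat C:V\otimes V\to\mathbb{C}$ is the map $v\otimes w\mapsto (v,w)$. The symmetric group $\mathrm{Sym}_r$ acts on $V^{\otimes r}$ by permuting tensor factors, and $\mathbb{C}\,\mathrm{Sym}_r(x)$ denotes the linear span of the $\mathrm{Sym}_r$-orbit of $x\in V^{\otimes r}$. An element $D\in V^{\otimes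 r}$ is called harmonic if $(\hat C\otimes \mathrm{id}_V^{\otimes (r-2)})(\sigma D)=0$ for all $\sigma\in\mathrm{Sym}_r$ (for $r<2$ this condition is vacuous). *)

(* Defs.v *)
From HB Require Import structures.
From mathcomp Require Import all_boot all_order all_fingroup all_algebra.
From mathcomp Require Import complex boolp classical_sets reals.

Set Implicit Arguments.
Unset Strict Implicit.
Unset Printing Implicit Defensive.

Import Order.TTheory GRing.Theory Num.Theory.

Local Open Scope ring_scope.
Local Open Scope classical_set_scope.

(* The r-th tensor power of V = 'cV[F]_m, a tensor being given by its          *)
(* coordinates on the basis e_(s 0) (x) ... (x) e_(s (r-1)), s : 'I_m ^ r,     *)
(* where the e_i are the standard basis vectors of V.                          *)
Notation tensor F m r := {ffun ('I_m ^ r)%type -> F^o}.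

Section Tensors.
Variables (F : fieldType) (m : nat).

Definition pure r (v : 'I_r -> 'cV[F]_m) : tensor F m r :=
  [ffun s : ('I_m ^ r)%type => \prod_i v i (s i) 0].

(* The linear map sending e_(s 0) (x) ... (x) e_(s (r-1)) to                   *)
(* f (e_(s 0), ..., e_(s (r-1))); if f is multilinear, this is the linear map  *)
(* sending pure v to f v for all v.                                            *)
Definition tlin r (W : lmodType F) (f : ('I_r -> 'cV[F]_m) -> W)
    (x : tensor F m r) : W :=
  \sum_s x s *: f (fun i => delta_mx (s i) 0).

Definition gact r (g : 'M[F]_m) : tensor F m r -> tensor F m r :=
  tlin (fun v => pure (fun i => g *m v i)).

Definition symact r (p : 'S_r) : tensor F m r -> tensor F m r :=
  tlin (fun v => pure (fun i => v ((p^-1)%g i))).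

Definition tcat r s (v : 'I_r -> 'cV[F]_m) (w : 'I_s -> 'cV[F]_m)
    (i : 'I_(r + s)) : 'cV[F]_m :=
  match split i with inl j => v j | inr k => w k end.

Definition tmul r s (x : tensor F m r) (y : tensor F m s) : tensor F m (r + s) :=
  tlin (fun v => tlin (fun w => pure (tcat v w)) y) x.

(* For k = 0 this is the empty tensor product 1 in V^{(x) 0} = F. *)
Fixpoint tpow r (x : tensor F m r) k : tensor F m (k * r) :=
  if k is k'.+1 then tmul x (tpow x k') else pure (fun _ => 0).

Definition tensor_cast r s (e : r = s) (x : tensor F m r) : tensor F m s :=
  ecast n (tensor F m n) e x.

Definition sym_span r (x : tensor F m r) : {vspace tensor F m r} :=
  <<[seq symact p x | p : 'S_r]>>%VS.

Variable B : {symmetric 'cV[F]_m}.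

Definition tform r (x y : tensor F m r) : F :=
  tlin (fun v => tlin (fun w => \prod_i B (v i) (w i) : F^o) y) x.

(* \hat C (x) id on V^{(x) (2 + r)} *)
Definition contract r : tensor F m (2 + r) -> tensor F m r :=
  tlin (fun v => B (v (lshift r 0)) (v (lshift r 1)) *:
                 pure (fun i => v (rshift 2 i))).

Definition harmonic r : tensor F m r -> Prop :=
  match r with
  | r'.+2 => fun D => forall p : 'S_(2 + r'), contract (symact p D) = 0
  | _ => fun _ => True
  end.

(* g ranges over O(V): the isometries of a nondegenerate form are automatically invertible. *)
Definition det_invariants r : set (tensor F m r) :=
  [set x | forall g : 'M[F]_m, isometry B B (mulmx g) ->
           gact g x = \det g *: x].

Definition orthonormal_basis (e : m.-tuple 'cV[F]_m) : bool :=
  basis_of fullv e && orthonormal B e.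

Definition checkC (e : m.-tuple 'cV[F]_m) : tensor F m 2 :=
  \sum_(i < m) pure (fun _ : 'I_2 => tnth e i).

End Tensors.

Arguments det_invariants {F m} B r.

Section PureTensors.
Variables (F : fieldType) (m : nat) (B : {symmetric 'cV[F]_m}).

Lemma col_delta_sum (u : 'cV[F]_m) : u = \sum_j u j 0 *: delta_mx j 0.
Proof. by rewrite {1}[u]matrix_sum_delta; apply: eq_bigr => j _; rewrite big_ord1. Qed.

Lemma gact_pure r (g : 'M[F]_m) (v : 'I_r -> 'cV[F]_m) :
  gact g (pure v) = pure (fun i => g *m v i).
Proof.
apply/ffunP => t; rewrite /gact /tlin sum_ffunE [in RHS]ffunE.
transitivity (\prod_(i < r) \sum_(j < m)
    v i j 0 * (g *m (delta_mx j 0 : 'cV[F]_m)) (t i) 0).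
  rewrite bigA_distr_bigA /=; apply: eq_bigr => s _.
  by rewrite !ffunE big_split.
apply: eq_bigr => i _; rewrite {2}(col_delta_sum (v i)) mulmx_sumr summxE.
by apply: eq_bigr => j _; rewrite -scalemxAr [in RHS]mxE.
Qed.

Lemma symactE r (p : 'S_r) (x : tensor F m r) :
  symact p x = [ffun t : ('I_m ^ r)%type => x [ffun i => t (p i)]].
Proof.
apply/ffunP => t; rewrite /symact /tlin sum_ffunE ffunE.
rewrite (bigD1 [ffun i => t (p i)]) //= big1 ?addr0.
  rewrite !ffunE big1 => [|i _]; first exact: mulr1.
  by rewrite !ffunE permKV mxE !eqxx.
move=> s; apply: contraNeq; rewrite !ffunE mulf_eq0 negb_or => /andP[_].
move=> /prodf_neq0 h; apply/eqP/ffunP => i; rewrite ffunE.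
have := h (p i) isT; rewrite permK mxE eqxx andbT.
by case: (t (p i) =P s i) => [->|]; rewrite ?eqxx.
Qed.

Lemma symact_pure r (p : 'S_r) (v : 'I_r -> 'cV[F]_m) :
  symact p (pure v) = pure (fun i => v ((p^-1)%g i)).
Proof.
rewrite symactE; apply/ffunP => t; rewrite !ffunE.
rewrite [RHS](reindex_inj (@perm_inj _ p)) /=.
by apply: eq_bigr => i _; rewrite ffunE permK.
Qed.

Lemma tmulE r s (x : tensor F m r) (y : tensor F m s) :
  tmul x y = [ffun t : ('I_m ^ (r + s))%type =>
    x [ffun i => t (lshift s i)] * y [ffun j => t (rshift r j)]].
Proof.
have catE (a : ('I_m ^ r)%type) (b : ('I_m ^ s)%type) (t : ('I_m ^ (r + s))%type) :
    pure (tcat (fun i => delta_mx (a i) 0) (fun j => delta_mx (b j) 0)) t =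
    ((a == [ffun i => t (lshift s i)]) && (b == [ffun j => t (rshift r j)]))%:R
    :> F.
  rewrite ffunE big_split_ord /= /tcat.
  under eq_bigr do rewrite (unsplitK (inl _)) mxE eqxx andbT.
  under [X in _ * X]eq_bigr do rewrite (unsplitK (inr _)) mxE eqxx andbT.
  rewrite -!natr_prod -natrM; congr _%:R.
  have prodb n (c d : 'I_m ^ n) :
      (\prod_(i < n) (c i == d i :> 'I_m) = (d == c) :> nat)%N.
    case: eqP => [->|nedc]; first by apply: big1 => i _; rewrite eqxx.
    have [i nei] : exists i, c i != d i.
      apply/existsP; apply: contra_notT nedc; rewrite negb_exists => /forallP h.
      by apply/ffunP => i; move: (h i); rewrite negbK => /eqP.
    by rewrite (bigD1 i) //= (negbTE nei).
  rewrite -mulnb; congr (_ * _)%N; rewrite -prodb;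
    by apply: eq_bigr => i _; rewrite ffunE.
apply/ffunP => t; rewrite ffunE /tmul /tlin.
set a0 := [ffun i => t (lshift s i)]; set b0 := [ffun j => t (rshift r j)].
transitivity (\sum_a \sum_b
    x a * (y b * ((a == a0) && (b == b0))%:R) : F).
  rewrite sum_ffunE; apply: eq_bigr => a _; rewrite ffunE sum_ffunE scaler_sumr.
  by apply: eq_bigr => b _; rewrite ffunE catE.
rewrite (bigD1 a0) //= [X in _ + X]big1 ?addr0 => [|a nea]; last first.
  by apply: big1 => b _; rewrite (negbTE nea) !mulr0.
rewrite (bigD1 b0) //= [X in _ + X]big1 ?addr0 => [|b neb]; last first.
  by rewrite (negbTE neb) andbF !mulr0.
by rewrite !eqxx mulr1.
Qed.

Lemma tmul_pure r s (v : 'I_r -> 'cV[F]_m) (w : 'I_s -> 'cV[F]_m) :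
  tmul (pure v) (pure w) = pure (tcat v w).
Proof.
rewrite tmulE; apply/ffunP => t; rewrite !ffunE big_split_ord /=.
congr (_ * _); apply: eq_bigr => i _; rewrite ffunE /tcat.
  by rewrite (unsplitK (inl _)).
by rewrite (unsplitK (inr _)).
Qed.

Lemma tform_pure r (v w : 'I_r -> 'cV[F]_m) :
  tform B (pure v) (pure w) = \prod_i B (v i) (w i).
Proof.
transitivity (\prod_(i < r) \sum_(j < m) \sum_(k < m)
    v i j 0 * (w i k 0 * B (delta_mx j 0) (delta_mx k 0))).
  rewrite bigA_distr_bigA /=; apply: eq_bigr => s _.
  rewrite bigA_distr_bigA /= scaler_sumr; apply: eq_bigr => t _.
  by rewrite !ffunE !big_split.
apply: eq_bigr => i _; rewrite [in RHS](col_delta_sum (v i)) linear_sumlz.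
apply: eq_bigr => j _; rewrite linearZl_LR /= [in RHS](col_delta_sum (w i)).
rewrite linear_sumr mulr_sumr; apply: eq_bigr => k _.
by rewrite linearZr_LR.
Qed.

Lemma contractE r (x : tensor F m (2 + r)) :
  contract B x = [ffun t : ('I_m ^ r)%type => \sum_j \sum_k
    x [ffun i => match split i with
                 | inl a => if a == 0 then j else k
                 | inr b => t b
                 end] * B (delta_mx j 0) (delta_mx k 0)].
Proof.
apply/ffunP => t; rewrite ffunE /contract /tlin sum_ffunE pair_big /=.
pose rest (s : ('I_m ^ (2 + r))%type) := [ffun i => s (rshift 2 i)].
rewrite (bigID (fun s => rest s == t)) /= addrC big1 ?add0r; last first.
  move=> s; apply: contraNeq; rewrite !ffunE !mulf_eq0 !negb_or.
  move=> /andP[_ /andP[_ /prodf_neq0 h]]; apply/eqP/ffunP => i.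
  rewrite ffunE; have := h i isT; rewrite mxE eqxx andbT.
  by case: (t i =P s (rshift 2 i)) => [->|]; rewrite ?eqxx.
rewrite (reindex_onto (fun p : 'I_m * 'I_m => [ffun i => match split i with
                 | inl a => if a == 0 then p.1 else p.2
                 | inr b => t b
                 end]) (fun s => (s (lshift r 0), s (lshift r 1)))) /=.
  apply: eq_big => [[j k]|[j k] _] /=.
    rewrite !ffunE !(unsplitK (inl _)) /= eqxx andbT; apply/eqP/ffunP => i.
    by rewrite !ffunE (unsplitK (inr _)).
  rewrite !ffunE !(unsplitK (inl _)) /= big1 => [|i _].
    by rewrite [_ *: 1]mulr1.
  by rewrite !ffunE (unsplitK (inr _)) mxE !eqxx.
move=> s /eqP <-; apply/ffunP => i; rewrite ffunE.
case: splitP => [a ia|b ib]; last by rewrite ffunE; congr (s _); apply: val_inj.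
case: a ia => [[|[|//]]] lta /= ia;
  by congr (s _); apply: val_inj.
Qed.

Lemma contract_pure r (v : 'I_(2 + r) -> 'cV[F]_m) :
  contract B (pure v) =
  B (v (lshift r 0)) (v (lshift r 1)) *: pure (fun i => v (rshift 2 i)).
Proof.
rewrite contractE; apply/ffunP => t; rewrite !ffunE.
rewrite [in RHS](col_delta_sum (v (lshift r 0))) linear_sumlz scaler_suml.
apply: eq_bigr => j _; rewrite linearZl_LR /=.
rewrite [in RHS](col_delta_sum (v (lshift r 1))) linear_sumr mulr_sumr scaler_suml.
apply: eq_bigr => k _; rewrite linearZr_LR /= ffunE big_split_ord /= big_ord_recl.
rewrite big_ord1 !ffunE !(unsplitK (inl _)) /=.
rewrite (_ : lshift r (lift ord0 ord0) = lshift r 1); last exact: val_inj.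
under eq_bigr do rewrite ffunE (unsplitK (inr _)).
have scE (a b : F) : a *: (b : F^o) = a * b by []; rewrite scE -!mulrA; congr (_ * (_ * _)); exact: mulrC.
Qed.

End PureTensors.

Section OrthonormalBasis.
Variables (C : numClosedFieldType) (m : nat) (B : {symmetric 'cV[C]_m}).

Lemma symform_sym u v : B u v = B v u.
Proof. by rewrite hermC /= expr0 mul1r. Qed.

Lemma ortho_rec1P u (s : seq 'cV[C]_m) :
  reflect {in <<s>>%VS, forall v, B u v = 0} (ortho_rec B [:: u] s).
Proof.
apply: (iffP idP) => [us v vs|us].
  have /orthovP/(_ u v) : (<<[:: u]>> <= orthov B <<s>>)%VS by rewrite -orthogonalE.
  by apply=> //; rewrite memv_span ?mem_head.
rewrite -[ortho_rec _ _ _]/(orthogonal B [:: u] s).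
by apply/orthogonalP => x v; rewrite inE => /eqP -> /memv_span/us.
Qed.

Lemma orthonormal_proj (s : seq 'cV[C]_m) : orthonormal B s ->
  free s /\ forall x, exists2 y, y \in <<s>>%VS & ortho_rec B [:: x - y] s.
Proof.
elim: s => [_|u s IHs]; first by split=> [|x]; [rewrite nil_free | exists 0; rewrite ?mem0v].
rewrite /orthonormal /= => /andP[/andP[/eqP uu s1] /andP[us os]].
have [frs projs] : free s /\ forall x, exists2 y, y \in <<s>>%VS & ortho_rec B [:: x - y] s.
  by apply: IHs; rewrite /orthonormal s1.
move/ortho_rec1P: us => us; split.
  rewrite free_cons frs andbT; apply/negP => /us; rewrite uu => /eqP.
  by rewrite oner_eq0.
move=> x; have [y ys /ortho_rec1P xy] := projs x.
exists (y + B x u *: u).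
  by rewrite span_cons addrC memv_add // memvZ // memv_line.
rewrite -[X in is_true X]/(ortho_rec B [:: x - (y + B x u *: u)] (u :: s)).
apply/ortho_rec1P => v; rewrite span_cons => /memv_addP[_ /vlineP[k ->]].
case=> w ws ->; have subl a b c : B (a - b) c = B a c - B b c by exact: linearBl.
have xyu : B (x - y) u = B x u by rewrite subl (symform_sym y) us // subr0.
rewrite opprD addrA linearDr /= linearZr_LR /= !(subl (x - y)) xyu xy //.
by rewrite !linearZl_LR /= (us w) // uu mulr1 subrr !mulr0 subr0 addr0.
Qed.

Lemma orthonormal_basis_exists :
  nondegenerate B -> exists e, orthonormal_basis B e.
Proof.
move=> ndB.
suff /(_ m (leqnn m)) [s ss os] : forall n, (n <= m)%N ->
    exists2 s : seq 'cV[C]_m, size s = n & orthonormal B s.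
  have [frs _] := orthonormal_proj os; move/eqP: ss => ss.
  exists (Tuple ss); rewrite /orthonormal_basis os andbT basisEfree /= frs.
  by rewrite subvf dimvf /dim /= muln1 (eqP ss) leqnn.
elim=> [|n IHn] ltnm; first by exists [::].
have [s ss os] := IHn (ltnW ltnm); have [frs projs] := orthonormal_proj os.
suff [u us uu] : exists2 u, ortho_rec B [:: u] s & B u u != 0.
  exists ((sqrtC (B u u))^-1 *: u :: s); first by rewrite /= ss.
  rewrite /orthonormal /= linearZr_LR linearZl_LR /= mulrA -invfM -expr2 sqrtCK.
  rewrite mulVf // eqxx /=; case/andP: os => -> -> /=; rewrite andbT.
  apply/ortho_rec1P => v vs; rewrite linearZl_LR /=.
  by rewrite (ortho_rec1P _ _ us v vs) mulr0.
have [w ws w0] : exists2 w : 'cV[C]_m, ortho_rec B [:: w] s & w != 0.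
  have [x xs] : exists x, x \notin <<s>>%VS.
    apply: contrapT => h; suff: (\dim (fullv : {vspace 'cV[C]_m}) <= n)%N.
      by rewrite dimvf /dim /= muln1 leqNgt ltnm.
    rewrite -ss (leq_trans _ (dim_span s)) //; apply/dimvS/subvP => x _.
    by apply: contrapT => /negP xs; apply: h; exists x.
  have [y ys xy] := projs x; exists (x - y) => //.
  by apply: contraNneq xs => /subr0_eq ->.
apply: contrapT => noiso; case/negP: w0.
have iso u : ortho_rec B [:: u] s -> B u u = 0.
  by move=> us; apply: contrapT => /eqP uu; apply: noiso; exists u.
move/eqP: ndB => radB; rewrite -memv0 -radB; apply/mem_orthovP => x _.
have [y ys xy] := projs x; rewrite -[x](subrK y) linearDr /=.
rewrite (ortho_rec1P _ _ ws y ys) addr0.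
have : B (w + (x - y)) (w + (x - y)) = 0.
  apply: iso; apply/ortho_rec1P => v vs; rewrite linearDl /=.
  by rewrite (ortho_rec1P _ _ ws v vs) (ortho_rec1P _ _ xy v vs) addr0.
rewrite hnormD /= (iso w ws) (iso _ xy) expr0 mul1r !add0r -mulr2n => /eqP.
by rewrite mulrn_eq0 => /eqP.
Qed.

End OrthonormalBasis.

Lemma sub_half_mul2 rc r : (rc <= r)%N -> ~~ odd (r - rc) ->
  (rc + (r - rc)./2 * 2)%N = r.
Proof. by move=> ler evr; rewrite muln2 even_halfK // subnKC. Qed.

(* Main.v *)
Require Import Defs.
From HB Require Import structures.
From mathcomp Require Import all_boot all_order all_fingroup all_algebra.
From mathcomp Require Import complex boolp classical_sets reals.
From mathcomp Require Import ring.

Import Order.TTheory GRing.Theory Num.Theory.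

Local Open Scope ring_scope.
Local Open Scope classical_set_scope.

Set Implicit Arguments.
Unset Strict Implicit.
Unset Printing Implicit Defensive.

Local Notation gact := Defs.gact.

(** Why the theorem holds.  An orthonormal basis identifies [V] with the space
    of column vectors and the form with the dot product, so that a tensor is a
    function on multi-indices [t : 'I_m ^ r] and the isometries are the
    matrices [g] with [g^T *m g = 1%:M].  Call [x] a determinant-invariant if
    each of them acts on [x] by its determinant.

    The heart of the matter is the case of harmonic tensors: the harmonic
    determinant-invariants are supported on the bijective multi-indices, hence
    live in degree [m] only, where they form at most a line.  Three families of
    isometries give this.  The reflection in the a-th coordinate shows that [a]
    occurs in every multi-index of the support ([dinv_onto]).  The infinitesimal
    rotations show that the derivations [eact a b] and [eact b a] induced by the
    matrix units agree on a determinant-invariant ([eactC]); since [eact b a] is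
    the adjoint of [eact a b] for the Hermitian product, and since for a
    harmonic [x] the sum over [a] and [b] of the [eact b a (eact b a x)] is
    [r] times [x] ([eact_casimir]), the squared lengths of the [eact a b x] add
    up to [r] times that of [x].  The diagonal terms alone already weigh the
    entry at [t] by the sum of the squares of the multiplicities in [t], which
    is at least [r], with equality only for injective [t]
    ([harmonic_dinv_inj]).  Finally permutation matrices determine all entries
    from a single one ([harmonic_dinv_line]).  In particular [rc = m] and every
    harmonic determinant-invariant is a multiple of [Lambda].

    The general case follows by induction on the degree.  Let [x] be a
    determinant-invariant orthogonal to all permutations of all tensors
    [Lambda (x) ccheck^k].  Contracting two factors of [x] is adjoint to
    inserting [ccheck], so the contractions of [x] satisfy the same assumption
    and vanish: [x] is harmonic, hence a multiple of [Lambda], and being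
    orthogonal to [Lambda] it is 0 ([dinv_orthogonal_eq0]).  So pairing with the
    span [S] of these tensors is injective on the space of
    determinant-invariants, whose dimension is thus at most that of [S], and
    which contains [S] ([separated_mem], [dinv_sym_span]). *)

(** * Coordinates of the operations on tensors *)

Section Coordinates.
Variables (F : fieldType) (m : nat).

Lemma prod_eqb n (s t : ('I_m ^ n)%type) :
  \prod_(i < n) ((s i == t i)%:R : F) = (s == t)%:R.
Proof.
case: eqP => [->|st]; first by rewrite big1 // => i _; rewrite eqxx.
apply/eqP/prodf_eq0/exists_inP.
apply: contra_notT st => /exists_inPn h; apply/ffunP => i; apply/eqP.
by apply: contraR (h i isT) => /negbTE ->.
Qed.

Lemma gactE r (g : 'M[F]_m) (x : tensor F m r) (t : ('I_m ^ r)%type) :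
  gact g x t = \sum_s (x s : F) * \prod_i g (t i) (s i) :> F.
Proof.
rewrite /Defs.gact /tlin sum_ffunE.
apply: eq_bigr => s _; rewrite !ffunE; congr (_ * _); apply: eq_bigr => i _.
rewrite mxE (bigD1 (s i)) //= mxE !eqxx mulr1 big1 ?addr0 // => j js.
by rewrite mxE (negbTE js) mulr0.
Qed.

Lemma symact_entry r (p : 'S_r) (x : tensor F m r) (t : ('I_m ^ r)%type) :
  symact p x t = x [ffun i => t (p i)] :> F.
Proof. by rewrite symactE ffunE. Qed.

Lemma tmul_entry r s (x : tensor F m r) (y : tensor F m s)
    (t : ('I_m ^ (r + s))%type) :
  tmul x y t = x [ffun i => t (lshift s i)] * y [ffun j => t (rshift r j)] :> F.
Proof. by rewrite tmulE ffunE. Qed.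

Lemma tensorZE r c (x : tensor F m r) t : (c *: x) t = c * x t :> F.
Proof. by rewrite ffunE. Qed.

Lemma gact_is_linear r (g : 'M[F]_m) : linear (@Defs.gact F m r g).
Proof.
move=> a x y; apply/ffunP => t; rewrite [RHS]ffunE tensorZE !gactE.
rewrite mulr_sumr -big_split /=; apply: eq_bigr => s _.
by rewrite ffunE tensorZE mulrDl mulrA.
Qed.

HB.instance Definition _ r (g : 'M[F]_m) :=
  GRing.isLinear.Build F (tensor F m r) (tensor F m r) _ (@Defs.gact F m r g)
    (gact_is_linear g).

Lemma gact_mul r (g h : 'M[F]_m) (x : tensor F m r) :
  gact g (gact h x) = gact (g *m h) x.
Proof.
apply/ffunP => t; rewrite !gactE.
under eq_bigr do rewrite gactE mulr_suml.
rewrite exchange_big /=; apply: eq_bigr => s _.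
under eq_bigr do rewrite -mulrA -big_split.
rewrite -mulr_sumr; congr (_ * _).
under [RHS]eq_bigr do rewrite mxE.
rewrite bigA_distr_bigA /=; apply: eq_bigr => u _; apply: eq_bigr => i _.
exact: mulrC.
Qed.

Lemma gact1 r (x : tensor F m r) : gact 1%:M x = x.
Proof.
apply/ffunP => t; rewrite gactE.
under eq_bigr => s _.
  under eq_bigr => i _ do rewrite mxE.
  rewrite prod_eqb; over.
rewrite (bigD1 t) //= eqxx mulr1 big1 ?addr0 // => s.
by rewrite eq_sym => /negbTE ->; rewrite mulr0.
Qed.

Lemma gactZ r c (g : 'M[F]_m) (x : tensor F m r) :
  gact (c *: g) x = c ^+ r *: gact g x.
Proof.
apply/ffunP => t; rewrite tensorZE !gactE mulr_sumr; apply: eq_bigr => s _.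
under eq_bigr do rewrite mxE.
by rewrite big_split /= prodr_const card_ord mulrCA.
Qed.

(** The permutation action, freed from the requirement that source and target
    have the same degree on the nose: it absorbs the casts between the types
    of tensors of provably equal degrees. *)
Definition permuted r s (x : tensor F m r) (y : tensor F m s) :=
  exists f : 'I_r -> 'I_s,
    bijective f /\ forall t : ('I_m ^ s)%type, y t = x [ffun i => t (f i)].

Lemma permuted_refl r (x : tensor F m r) : permuted x x.
Proof.
exists id; split=> [|t]; first by exists id.
by congr (x _); apply/ffunP => i; rewrite ffunE.
Qed.

Lemma permuted_trans r s q (y : tensor F m s) (x : tensor F m r)
    (z : tensor F m q) :
  permuted x y -> permuted y z -> permuted x z.
Proof.
move=> [f [bf fE]] [g [bg gE]]; exists (g \o f).
split=> [|t]; first exact: bij_comp.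
by rewrite gE fE; congr (x _); apply/ffunP => i; rewrite !ffunE.
Qed.

Lemma permuted_size r s (x : tensor F m r) (y : tensor F m s) :
  permuted x y -> r = s.
Proof. by case=> f [/bij_eq_card]; rewrite !card_ord. Qed.

Lemma permuted_cast r s (e : r = s) (x : tensor F m r) :
  permuted x (tensor_cast e x).
Proof. by case: s / e; apply: permuted_refl. Qed.

Lemma permuted_symact r (p : 'S_r) (x : tensor F m r) : permuted x (symact p x).
Proof.
exists p; split=> [|t]; first by exists (p^-1)%g; [exact: permK|exact: permKV].
by rewrite symact_entry.
Qed.

Lemma permutedP r (x y : tensor F m r) :
  permuted x y -> exists p, y = symact p x.
Proof.
case=> f [bf fE]; exists (perm (bij_inj bf)); apply/ffunP => t.
rewrite fE symact_entry; congr (x _).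
by apply/ffunP => i; rewrite !ffunE permE.
Qed.

Lemma permuted_sym r s (x : tensor F m r) (y : tensor F m s) :
  permuted x y -> permuted y x.
Proof.
case=> f [[g fK gK] fE]; exists g; split=> [|t]; first by exists f.
by rewrite fE; congr (x _); apply/ffunP => i; rewrite !ffunE fK.
Qed.

Lemma permuted_tmul r r' s s' (x : tensor F m r) (x' : tensor F m r')
    (y : tensor F m s) (y' : tensor F m s') :
  permuted x x' -> permuted y y' -> permuted (tmul x y) (tmul x' y').
Proof.
move=> [f [[f' fK f'K] fE]] [g [[g' gK g'K] gE]].
pose h (a : 'I_(r + s)) : 'I_(r' + s') :=
  match split a with inl i => lshift s' (f i) | inr j => rshift r' (g j) end.
pose h' (a : 'I_(r' + s')) : 'I_(r + s) :=
  match split a with inl i => lshift s (f' i) | inr j => rshift r (g' j) end.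
exists h; split=> [|t].
  exists h' => a; rewrite /h /h' -[RHS]splitK; case: (split a) => i /=.
  - by rewrite (unsplitK (inl _)) fK.
  - by rewrite (unsplitK (inr _)) gK.
  - by rewrite (unsplitK (inl _)) f'K.
  - by rewrite (unsplitK (inr _)) g'K.
rewrite !tmul_entry fE gE; congr (x _ * y _); apply/ffunP => i.
  by rewrite !ffunE /h (unsplitK (inl _)).
by rewrite !ffunE /h (unsplitK (inr _)).
Qed.

Lemma permuted_tmulC r s (x : tensor F m r) (y : tensor F m s) :
  permuted (tmul x y) (tmul y x).
Proof.
pose h a b (k : 'I_(a + b)) : 'I_(b + a) :=
  match split k with inl i => rshift b i | inr j => lshift a j end.
have hK a b : cancel (h a b) (h b a).
  move=> k; rewrite /h -[RHS]splitK; case: (split k) => i /=.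
    by rewrite (unsplitK (inr _)).
  by rewrite (unsplitK (inl _)).
exists (h r s); split=> [|t]; first by exists (h s r).
rewrite !tmul_entry mulrC; congr (x _ * y _); apply/ffunP => i.
  by rewrite !ffunE /h (unsplitK (inl _)).
by rewrite !ffunE /h (unsplitK (inr _)).
Qed.

Lemma permuted_tmulA r s q (x : tensor F m r) (y : tensor F m s)
    (z : tensor F m q) :
  permuted (tmul (tmul x y) z) (tmul x (tmul y z)).
Proof.
exists (cast_ord (esym (addnA r s q))); split=> [|t].
  by exists (cast_ord (addnA r s q)) => i; apply: val_inj.
rewrite !tmul_entry mulrA; congr (x _ * y _ * z _); apply/ffunP => i;
  rewrite !ffunE; congr (t _); apply: val_inj => //=.
by rewrite addnA.
Qed.

(** Stated with the bijection explicit, because the same one relates the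
    transformed tensors. *)
Lemma gact_permuted r s (f : 'I_r -> 'I_s) (x : tensor F m r)
    (y : tensor F m s) (g : 'M[F]_m) : bijective f ->
  (forall t : ('I_m ^ s)%type, y t = x [ffun i => t (f i)]) ->
  forall t : ('I_m ^ s)%type, gact g y t = gact g x [ffun i => t (f i)].
Proof.
move=> bf fE t; have [f' fK f'K] := bf; rewrite !gactE.
rewrite (reindex (fun u : ('I_m ^ r)%type => [ffun j => u (f' j)])) /=;
  last first.
  exists (fun v : ('I_m ^ s)%type => [ffun i => v (f i)]) => u _;
    by apply/ffunP => i; rewrite !ffunE ?fK ?f'K.
apply: eq_bigr => u _; rewrite fE; congr (x _ * _).
  by apply/ffunP => i; rewrite !ffunE fK.
rewrite (reindex f) /=; last exact: onW_bij.
by apply: eq_bigr => i _; rewrite !ffunE fK.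
Qed.

Lemma gact_symact r (g : 'M[F]_m) (p : 'S_r) (x : tensor F m r) :
  gact g (symact p x) = symact p (gact g x).
Proof.
apply/ffunP => t; rewrite [in RHS]symact_entry.
apply: (gact_permuted (f := p)) => [|u].
  by exists (p^-1)%g; [exact: permK|exact: permKV].
by rewrite symact_entry.
Qed.

Lemma gact_cast r s (e : r = s) (g : 'M[F]_m) (x : tensor F m r) :
  gact g (tensor_cast e x) = tensor_cast e (gact g x).
Proof. by case: s / e. Qed.

Lemma gact_tmul r s (g : 'M[F]_m) (x : tensor F m r) (y : tensor F m s) :
  gact g (tmul x y) = tmul (gact g x) (gact g y).
Proof.
apply/ffunP => t; rewrite [RHS]tmul_entry !gactE.
rewrite mulr_suml; under [RHS]eq_bigr do rewrite mulr_sumr.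
rewrite pair_big /=.
pose h (u : ('I_m ^ r)%type * ('I_m ^ s)%type) : ('I_m ^ (r + s))%type :=
  [ffun k => match split k with inl i => u.1 i | inr j => u.2 j end].
rewrite (reindex h) /=; last first.
  exists (fun v : ('I_m ^ (r + s))%type =>
    ([ffun i => v (lshift s i)], [ffun j => v (rshift r j)])).
    move=> [u v] _; congr (_, _); apply/ffunP => i; rewrite !ffunE.
      by rewrite (unsplitK (inl _)).
    by rewrite (unsplitK (inr _)).
  move=> v _; apply/ffunP => k; rewrite ffunE -[in RHS](splitK k).
  by case: (split k) => i; rewrite ffunE.
apply: eq_bigr => [[u v] _] /=; rewrite tmul_entry big_split_ord /= mulrACA.
congr (x _ * _ * (y _ * _)).
- by apply/ffunP => i; rewrite !ffunE (unsplitK (inl _)).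
- by apply: eq_bigr => i _; rewrite !ffunE (unsplitK (inl _)).
- by apply/ffunP => i; rewrite !ffunE (unsplitK (inr _)).
- by apply: eq_bigr => i _; rewrite !ffunE (unsplitK (inr _)).
Qed.

Lemma gact_tpow r k (g : 'M[F]_m) (x : tensor F m r) :
  gact g (tpow x k) = tpow (gact g x) k.
Proof.
elim: k => [|k IHk] /=; last by rewrite gact_tmul IHk.
by rewrite gact_pure; apply/ffunP => t; rewrite !ffunE !big_ord0.
Qed.

Lemma tensor_neq0P r (x : tensor F m r) : reflect (exists t, x t != 0) (x != 0).
Proof.
apply: (iffP idP) => [/eqP x0|[t]]; last first.
  by apply: contraNneq => ->; rewrite ffunE.
apply: contra_notP x0 => h; apply/ffunP => t; rewrite ffunE.
by apply/eqP/negPn/negP => xt; apply: h; exists t.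
Qed.

Lemma tmul_neq0 r s (x : tensor F m r) (y : tensor F m s) :
  x != 0 -> y != 0 -> tmul x y != 0.
Proof.
move=> /tensor_neq0P[u xu] /tensor_neq0P[v yv]; apply/tensor_neq0P.
exists [ffun k => match split k with inl i => u i | inr j => v j end].
rewrite tmul_entry; apply: mulf_neq0.
  rewrite [X in x X](_ : _ = u) //; apply/ffunP => i.
  by rewrite !ffunE (unsplitK (inl _)).
rewrite [X in y X](_ : _ = v) //; apply/ffunP => i.
by rewrite !ffunE (unsplitK (inr _)).
Qed.

(** Keeping the Gram matrix [M] as a parameter allows the contractions for two
    forms that differ by a change of basis to be compared. *)
Definition mxcontract r (M : 'M[F]_m) (x : tensor F m (2 + r)) : tensor F m r :=
  [ffun t : ('I_m ^ r)%type => \sum_j \sum_k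
    x [ffun i => match split i with
                 | inl a => if a == 0 then j else k
                 | inr b => t b
                 end] * M j k].

Lemma mxcontract_gact r (M g : 'M[F]_m) (x : tensor F m (2 + r)) :
  mxcontract M (gact g x) = gact g (mxcontract (g^T *m M *m g) x).
Proof.
pose cons2 (p : 'I_m * 'I_m) (t : ('I_m ^ r)%type) : ('I_m ^ (2 + r))%type :=
  [ffun i => match split i with
             | inl a => if a == 0 then p.1 else p.2
             | inr b => t b
             end].
apply/ffunP => t; rewrite gactE ffunE.
have sum2 (G : ('I_m ^ (2 + r))%type -> F) :
    \sum_s G s = \sum_u \sum_p G (cons2 p u).
  rewrite exchange_big pair_big /= (reindex (fun p => cons2 p.1 p.2)) //=.
  exists (fun s =>
    ((s (lshift r 0), s (lshift r 1)), [ffun i => s (rshift 2 i)])).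
    move=> [[j k] u] _; congr (_, _, _); rewrite ?ffunE ?(unsplitK (inl _)) //.
    by apply/ffunP => i; rewrite !ffunE (unsplitK (inr _)).
  move=> s _; apply/ffunP => i; rewrite ffunE -[in RHS](splitK i).
  case: (split i) => a; last by rewrite ffunE.
  by case: a => [[|[|//]]] lta /=; congr (s _); apply: val_inj.
have prod2 j k (p : 'I_m * 'I_m) u :
    \prod_i g (cons2 (j, k) t i) (cons2 p u i) =
    g j p.1 * g k p.2 * \prod_i g (t i) (u i).
  rewrite big_split_ord big_ord_recl big_ord1 /= !ffunE !(unsplitK (inl _)) /=.
  by congr (_ * _); apply: eq_bigr => i _; rewrite !ffunE (unsplitK (inr _)).
transitivity (\sum_j \sum_k \sum_u \sum_p
   x (cons2 p u) * (g j p.1 * g k p.2 * \prod_i g (t i) (u i)) * M j k).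
  apply: eq_bigr => j _; apply: eq_bigr => k _.
  rewrite gactE sum2 mulr_suml; apply: eq_bigr => u _.
  by rewrite mulr_suml; apply: eq_bigr => p _; rewrite -prod2.
rewrite pair_big exchange_big /=; apply: eq_bigr => u _.
rewrite ffunE mulr_suml; under [RHS]eq_bigr do rewrite mulr_suml.
rewrite [RHS]pair_big exchange_big /=; apply: eq_bigr => [[a b] _] /=.
rewrite -(pair_bigA _ (fun j k => (x (cons2 (a, b) u) : F) *
  (g j a * g k b * \prod_i g (t i) (u i)) * M j k)) /= exchange_big /=.
rewrite mxE mulr_sumr mulr_suml; apply: eq_bigr => k _.
rewrite mxE mulr_suml mulr_sumr mulr_suml; apply: eq_bigr => j _.
by rewrite mxE; ring.
Qed.
End Coordinates.

(** * The infinitesimal form of invariance *)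

Section Infinitesimal.
Variables (C : numClosedFieldType) (m : nat).

(** The case of [det_invariants] where the form is the dot product. *)
Definition dinv r (x : tensor C m r) :=
  forall g : 'M[C]_m, g^T *m g = 1%:M -> gact g x = \det g *: x.

Definition upd r (t : ('I_m ^ r)%type) (i : 'I_r) (c : 'I_m) :
    ('I_m ^ r)%type :=
  [ffun k => if k == i then c else t k].

Lemma upd_id r (t : ('I_m ^ r)%type) i : upd t i (t i) = t.
Proof. by apply/ffunP => k; rewrite ffunE; case: eqP => [->|]. Qed.

Lemma upd_same r (t : ('I_m ^ r)%type) i c : upd t i c i = c.
Proof. by rewrite ffunE eqxx. Qed.

Lemma upd_upd r (t : ('I_m ^ r)%type) i c d : upd (upd t i c) i d = upd t i d.
Proof. by apply/ffunP => k; rewrite !ffunE; case: eqP. Qed.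

(** The derivation of the tensor powers that extends the matrix unit with its
    entry 1 in position (a, b). *)
Definition eact r (a b : 'I_m) (x : tensor C m r) : tensor C m r :=
  [ffun t : ('I_m ^ r)%type => \sum_i (t i == a)%:R * x (upd t i b)].

Lemma eactE r a b (x : tensor C m r) t :
  eact a b x t = \sum_i (t i == a)%:R * (x (upd t i b) : C) :> C.
Proof. by rewrite ffunE. Qed.

Lemma deriv_prod (I : eqType) (s : seq I) (P : I -> {poly C}) : uniq s ->
  (\prod_(i <- s) P i)^`() =
  \sum_(i <- s) (P i)^`() * \prod_(j <- s | j != i) P j.
Proof.
elim: s => [|h s IHs] /=; first by rewrite !big_nil derivE.
case/andP=> hs us; rewrite !big_cons derivM eqxx IHs //=; congr (_ * _ + _).
  rewrite [LHS]big_seq [RHS]big_seq_cond; apply: eq_bigl => j.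
  by case: eqP hs => [->|_] /=; rewrite ?andbT // => /negbTE ->.
rewrite mulr_sumr [LHS]big_seq [RHS]big_seq; apply: eq_bigr => i si.
rewrite big_cons ifT; first exact: mulrCA.
by apply: contraNneq hs => ->.
Qed.

Lemma sum_upd r (u : ('I_m ^ r)%type) i (G : ('I_m ^ r)%type -> C) :
  \sum_s G s * \prod_(j | j != i) (u j == s j)%:R = \sum_c G (upd u i c).
Proof.
rewrite (bigID (fun s : ('I_m ^ r)%type => upd u i (s i) == s)) /=.
rewrite addrC big1 ?add0r; last first.
  move=> s; apply: contraNeq; rewrite mulf_eq0 negb_or.
  move=> /andP[_ /prodf_neq0 h].
  apply/eqP/ffunP => j; rewrite ffunE; case: (eqVneq j i) => [-> //|ji].
  by apply/eqP; apply: contraR (h j ji) => /negbTE ->.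
rewrite (reindex_onto (fun c => upd u i c)
  (fun s : ('I_m ^ r)%type => s i)) /=; last by move=> s /eqP.
apply: eq_big => [c|c _]; first by rewrite upd_same !eqxx.
by rewrite big1 ?mulr1 // => j ji; rewrite ffunE (negbTE ji) eqxx.
Qed.

Lemma poly_natP (p : {poly C}) : (forall n : nat, p.[n%:R] = 0) -> p = 0.
Proof.
move=> h; apply: (@roots_geq_poly_eq0 _ p [seq n%:R | n <- iota 0 (size p)]).
- by apply/allP => _ /mapP[n _ ->]; rewrite rootE h.
- by rewrite map_inj_uniq ?iota_uniq //; apply: mulrIn; rewrite oner_eq0.
- by rewrite size_map size_iota.
Qed.

Lemma det_orth_sqr (g : 'M[C]_m) : g^T *m g = 1%:M -> (\det g) ^+ 2 = 1.
Proof. by move=> go; rewrite expr2 -{1}det_tr -det_mulmx go det1. Qed.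

(** Differentiation of the invariance along a curve of isometries [A / q], where
    [A] is the identity at 0.  The curve is taken rational so that
    polynomial identities can replace analysis.  The determinant along the curve
    is left undetermined: its square is 1, so the polynomial [p] giving the
    entry of the transformed tensor has the square of [w], hence is [w] or
    [- w], and in both cases its derivative at 0 vanishes. *)
Lemma lie_of_curve r (A : 'I_m -> 'I_m -> {poly C}) (q : {poly C})
    (x : tensor C m r) :
  dinv x ->
  (forall i j, (A i j).[0] = (i == j)%:R) -> q^`().[0] = 0 ->
  (forall n : nat, q.[n%:R] != 0) ->
  (forall n : nat, let N := \matrix_(i, j) (A i j).[n%:R] in
     N^T *m N = (q.[n%:R] ^+ 2)%:M) ->
  forall u : ('I_m ^ r)%type,
    \sum_i \sum_c (A (u i) c)^`().[0] * (x (upd u i c) : C) = 0.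
Proof.
move=> dx A0 q'0 qn AO u.
pose p : {poly C} :=
  \sum_(s : ('I_m ^ r)%type) (x s : C)%:P * \prod_i A (u i) (s i).
pose w := (x u : C)%:P * q ^+ r.
have pE : p^`().[0] = \sum_i \sum_c (A (u i) c)^`().[0] * (x (upd u i c) : C).
  rewrite /p raddf_sum horner_sum.
  under eq_bigr => s _.
    rewrite /= derivM derivC mul0r add0r hornerM hornerC.
    rewrite deriv_prod ?index_enum_uniq // horner_sum mulr_sumr.
    under eq_bigr => i _.
      rewrite hornerM horner_prod; under eq_bigr do rewrite A0.
      rewrite mulrA; over.
    over.
  rewrite exchange_big; apply: eq_bigr => i _.
  rewrite (sum_upd _ _ (fun s : ('I_m ^ r)%type =>
    (x s : C) * (A (u i) (s i))^`().[0])).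
  by apply: eq_bigr => c _; rewrite upd_same mulrC.
have w'0 : w^`().[0] = 0.
  by rewrite /w derivM derivC mul0r add0r deriv_exp !(hornerM, hornerMn) q'0
    ?(mulr0, mul0r, mul0rn).
have : (p - w) * (p + w) = 0.
  rewrite -subr_sqr; apply: poly_natP => n; rewrite hornerD hornerN !horner_exp.
  pose N := \matrix_(i, j) (A i j).[n%:R].
  have gO : (q.[n%:R]^-1 *: N)^T *m (q.[n%:R]^-1 *: N) = 1%:M.
    have -> : (q.[n%:R]^-1 *: N)^T = q.[n%:R]^-1 *: N^T.
      by apply/matrixP => i j; rewrite !mxE.
    rewrite -scalemxAl -scalemxAr AO scalerA scale_scalar_mx.
    by rewrite -invfM -expr2 mulVf // expf_neq0.
  have pn : p.[n%:R] = gact N x u.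
    rewrite gactE horner_sum; apply: eq_bigr => s _.
    rewrite hornerM hornerC horner_prod; congr (_ * _).
    by apply: eq_bigr => i _; rewrite mxE.
  have NE : N = q.[n%:R] *: (q.[n%:R]^-1 *: N).
    by rewrite scalerA mulfV // scale1r.
  rewrite pn NE gactZ dx // tensorZE tensorZE.
  rewrite hornerM hornerC horner_exp !exprMn (det_orth_sqr gO).
  by rewrite mul1r mulrC subrr.
move/eqP; rewrite mulf_eq0 subr_eq0 addr_eq0 -pE.
by case/orP=> /eqP ->; rewrite ?derivN ?hornerN w'0 ?oppr0.
Qed.

(** The infinitesimal rotation in the (a, b)-plane.  The rational curve through
    the identity is made of the reflections along [w = e_a + z e_b], composed
    with the reflection [D] along [e_a]; the latter are represented by [v] and
    [d], and [q] clears the denominator [w^T *m w = 1 + z ^+ 2]. *)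
Lemma eactC r (x : tensor C m r) a b : dinv x -> eact a b x = eact b a x.
Proof.
move=> dx; have [->//|ab] := eqVneq a b; apply/ffunP => u.
have natC (k : nat) : (k%:R : {poly C}) = (k%:R : C)%:P by rewrite polyCMn.
pose v (i : 'I_m) : {poly C} := (i == a)%:R + (i == b)%:R * 'X.
have vE i z : (v i).[z] = (i == a)%:R + (i == b)%:R * z.
  by rewrite /v !natC !hornerE.
have v'E i z : (v i)^`().[z] = (i == b)%:R.
  by rewrite /v !natC derivD derivM !derivC derivX mul0r !add0r mulr1 hornerC.
pose q : {poly C} := 1 + 'X ^+ 2.
have qE z : q.[z] = 1 + z ^+ 2 by rewrite /q !hornerE.
have q'E : q^`().[0] = 0 by rewrite /q !derivE !hornerE.
pose d (i : 'I_m) : C := (-1) ^+ (i == a).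
clearbody v q.
pose A i j := (q * (i == j)%:R%:P - 2%:R%:P * (v i * v j)) * (d j)%:P.
have AE i j z : (A i j).[z] = ((1 + z ^+ 2) * (i == j)%:R -
    2%:R * (((i == a)%:R + (i == b)%:R * z) * ((j == a)%:R + (j == b)%:R * z)))
    * d j.
  by rewrite /A !(hornerM, hornerD, hornerN, hornerC) qE !vE.
have ab' (i : 'I_m) : (i == a) && (i == b) = false.
  by case: eqP => // ->; rewrite (negbTE ab).
have A'E i j : (A i j)^`().[0] =
    2%:R * ((i == b)%:R * (j == a)%:R - (i == a)%:R * (j == b)%:R).
  rewrite /A !(derivM, derivD, derivN, derivC).
  rewrite !(hornerM, hornerD, hornerN, hornerC) q'E !v'E !vE /d.
  have := ab' i; have := ab' j.
  by case: (i == a); case: (i == b); case: (j == a); case: (j == b) => // _ _;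
    rewrite /= ?expr0 ?expr1; ring.
have lie : \sum_i \sum_c (A (u i) c)^`().[0] * (x (upd u i c) : C) = 0.
  apply: (lie_of_curve (q := q) dx) => [i j||n|n].
  - rewrite AE expr0n /= addr0 mul1r !mulr0 !addr0 /d.
    have [->|ij] := eqVneq i j.
      by case: (j == a); rewrite /= ?expr0 ?expr1; ring.
    have : (i == a) && (j == a) = false.
      by apply: contraNF ij => /andP[/eqP-> /eqP->].
    by case: (i == a); case: (j == a) => // _; rewrite /= ?expr0 ?expr1; ring.
  - exact: q'E.
  - by rewrite qE -natrX -[1]/(1%:R) -natrD pnatr_eq0.
  - move: (n%:R : C) => z; set N := \matrix_(i, j) _.
    pose w : 'cV[C]_m := \col_i ((i == a)%:R + (i == b)%:R * z).
    pose D : 'M[C]_m := diag_mx (\row_j d j).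
    have NE : N = (q.[z]%:M - 2%:R *: (w *m w^T)) *m D.
      apply/matrixP => i j; rewrite /D mul_mx_diag !mxE AE big_ord1 !mxE qE.
      by rewrite mulr_natr.
    have ww : w^T *m w = q.[z]%:M.
      apply/matrixP => i j; rewrite !ord1 !mxE eqxx mulr1n qE.
      rewrite (bigD1 a) //= (bigD1 b) 1?eq_sym //= big1 => [|k /andP[ka kb]].
        by rewrite !mxE !eqxx (negbTE ab) (eq_sym b) (negbTE ab) /=
           !(mul0r, mul1r, add0r, addr0).
      by rewrite !mxE (negbTE ka) (negbTE kb) !(mul0r, add0r).
    have DD : D^T *m D = 1%:M.
      rewrite tr_diag_mx mulmx_diag -diag_const_mx; congr diag_mx.
      by apply/rowP => j; rewrite !mxE -expr2 sqrr_sign.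
    set Q := q.[z]%:M - _ in NE.
    have QT : Q^T = Q.
      apply/matrixP => i j; rewrite !mxE !big_ord1 !mxE [j == i]eq_sym.
      by congr (_ - _ * _); exact: mulrC.
    have QQ : Q *m Q = (q.[z] ^+ 2)%:M.
      rewrite /Q mulmxBl mul_scalar_mx -scalemxAl mulmxBr mul_mx_scalar.
      rewrite -scalemxAr mulmxA -(mulmxA w) ww mul_mx_scalar -scalemxAl.
      move: (w *m w^T) => W; apply/matrixP => i j; rewrite !mxE expr2.
      by case: (i == j); rewrite /= ?mulr1n ?mulr0n; ring.
    rewrite /= NE trmx_mul QT mulmxA -(mulmxA D^T) QQ mul_mx_scalar.
    by rewrite -scalemxAl DD scalemx1.
have pick k l i : \sum_c (u i == k)%:R * (c == l)%:R * (x (upd u i c) : C) =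
    (u i == k)%:R * (x (upd u i l) : C).
  rewrite (bigD1 l) //= eqxx mulr1 big1 ?addr0 // => c /negbTE ->.
  by rewrite mulr0 mul0r.
have : 2%:R * (eact b a x u - eact a b x u : C) = 0.
  rewrite -lie !eactE -sumrB mulr_sumr; apply: eq_bigr => i _.
  rewrite -!pick -sumrB mulr_sumr; apply: eq_bigr => c _.
  by rewrite A'E; ring.
by move/eqP; rewrite mulf_eq0 pnatr_eq0 /= subr_eq0 => /eqP.
Qed.
End Infinitesimal.

(** * Harmonic determinant-invariants *)

Section Harmonic.
Variables (C : numClosedFieldType) (m : nat).

(** Harmonicity for the dot product: the contraction of any two factors is 0.
    The insertions [upd] avoid reordering the factors. *)
Definition traceless r (x : tensor C m r) :=
  forall (i j : 'I_r) (t : ('I_m ^ r)%type), i != j ->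
    \sum_c (x (upd (upd t i c) j c) : C) = 0.

Lemma gact_monomial r (d : 'I_m -> C) (p : 'S_m)
    (x : tensor C m r) (t : ('I_m ^ r)%type) :
  gact (\matrix_(i, j) (d i * (p i == j)%:R)) x t =
  (\prod_i d (t i)) * (x [ffun i => p (t i)] : C) :> C.
Proof.
rewrite gactE (bigD1 [ffun i => p (t i)]) //= [X in _ + X]big1 ?addr0.
  rewrite mulrC; congr (_ * _); apply: eq_bigr => i _.
  by rewrite !mxE ffunE eqxx mulr1.
move=> s st; under eq_bigr do rewrite mxE.
rewrite big_split /=; suff -> : \prod_i ((p (t i) == s i)%:R : C) = 0.
  by rewrite !mulr0.
apply/eqP/prodf_eq0/exists_inP; apply: contraR st => /exists_inPn h.
apply/eqP/ffunP => i; rewrite ffunE; apply/esym/eqP.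
by apply: contraR (h i isT) => /negbTE ->.
Qed.

(** The reflection in the a-th coordinate fixes the entry at [t] unless [a]
    occurs in [t], while its determinant is -1. *)
Lemma dinv_onto r (x : tensor C m r)
    (t : ('I_m ^ r)%type) a :
  dinv x -> x t != 0 -> exists i, t i = a.
Proof.
move=> dx xt; apply: contrapT => na.
pose d i : C := (-1) ^+ (i == a).
have dE : \matrix_(i, j) (d i * ((1%g : 'S_m) i == j)%:R) =
    diag_mx (\row_j d j).
  apply/matrixP => i j; rewrite !mxE perm1.
  by case: eqP => [->|_]; rewrite ?mulr1n ?mulr0n ?mulr1 ?mulr0.
have go : (diag_mx (\row_j d j))^T *m diag_mx (\row_j d j) = 1%:M.
  rewrite tr_diag_mx mulmx_diag -diag_const_mx; congr diag_mx.
  by apply/rowP => j; rewrite !mxE -expr2 sqrr_sign.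
have := gact_monomial d 1%g x t; rewrite dE dx // tensorZE.
rewrite det_diag (bigD1 a) //= big1 => [|i /negbTE ia]; last first.
  by rewrite mxE /d ia.
rewrite mxE /d eqxx expr1 mulr1 big1 => [|i _]; last first.
  by case: eqP => // ta; case: na; exists i.
have -> : [ffun i => (1%g : 'S_m) (t i)] = t.
  by apply/ffunP => i; rewrite ffunE perm1.
move/eqP; rewrite mulN1r mul1r eq_sym -addr_eq0 -mulr2n mulrn_eq0 /=.
exact/negP.
Qed.

Lemma dinv_perm r (x : tensor C m r) (p : 'S_m)
    (t : ('I_m ^ r)%type) :
  dinv x -> x [ffun i => p (t i)] = (-1) ^+ p * (x t : C) :> C.
Proof.
move=> dx.
have pE : \matrix_(i, j) (1 * (p i == j)%:R) = perm_mx p :> 'M[C]_m.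
  by apply/matrixP => i j; rewrite !mxE mul1r.
have := gact_monomial (fun=> 1) p x t.
rewrite big1 // mul1r => <-; rewrite pE dx ?tensorZE ?det_perm //.
by rewrite tr_perm_mx -perm_mxM mulVg perm_mx1.
Qed.

Lemma eact_adj r (a b : 'I_m) (x y : tensor C m r) :
  \sum_t (eact a b x t : C) * y t = \sum_t (x t : C) * eact b a y t.
Proof.
under eq_bigr do rewrite eactE mulr_suml.
under [RHS]eq_bigr do rewrite eactE mulr_sumr.
rewrite exchange_big [RHS]exchange_big; apply: eq_bigr => i _ /=.
transitivity (\sum_(t : ('I_m ^ r)%type | t i == a) (x (upd t i b) : C) * y t).
  rewrite [RHS]big_mkcond; apply: eq_bigr => t _.
  by case: (t i == a); rewrite ?mul1r ?mul0r.
transitivity (\sum_(t : ('I_m ^ r)%type | t i == b) (x t : C) * y (upd t i a));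
  last first.
  rewrite big_mkcond; apply: eq_bigr => t _.
  by case: (t i == b); rewrite ?mul1r ?mul0r ?mulr0.
rewrite (reindex_onto (fun t : ('I_m ^ r)%type => upd t i a)
  (fun t : ('I_m ^ r)%type => upd t i b)) /=; last first.
  by move=> t /eqP <-; rewrite upd_upd upd_id.
apply: eq_big => [t|t /andP[_ /eqP e]]; last by rewrite e.
rewrite upd_same eqxx upd_upd /=; apply/eqP/eqP => [<-|<-].
  by rewrite upd_same.
by rewrite upd_id.
Qed.

Lemma sum_delta (k : 'I_m) (G : 'I_m -> C) : \sum_l (k == l)%:R * G l = G k.
Proof.
rewrite (bigD1 k) //= eqxx mul1r big1 ?addr0 // => l.
by rewrite eq_sym => /negbTE ->; rewrite mul0r.
Qed.

(** The terms where the two derivations hit different factors add up to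
    contractions of [x], which vanish; when they hit the same factor, only
    [a = b] contributes, once for each of the [r] factors. *)
Lemma eact_casimir r (x : tensor C m r)
    (t : ('I_m ^ r)%type) : traceless x ->
  \sum_a \sum_b (eact b a (eact b a x) t : C) = r%:R * (x t : C).
Proof.
move=> tx; transitivity (\sum_(i < r) \sum_(j < r) \sum_(a : 'I_m)
    (upd t i a j == t i)%:R * (x (upd (upd t i a) j a) : C)).
  transitivity (\sum_(a : 'I_m) \sum_(i < r) \sum_(j < r)
      (upd t i a j == t i)%:R * (x (upd (upd t i a) j a) : C)); last first.
    rewrite exchange_big; apply: eq_bigr => i _; exact: exchange_big.
  apply: eq_bigr => a _.
  under eq_bigr do rewrite eactE.
  rewrite exchange_big; apply: eq_bigr => i _.
  exact: etrans (sum_delta (t i) _) (eactE _ _ _ _).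
transitivity (\sum_(i < r) (x t : C)); last first.
  by rewrite sumr_const card_ord mulr_natl.
apply: eq_bigr => i _; rewrite (bigD1 i) //= [X in _ + X]big1 ?addr0 => [|j ji].
  transitivity (\sum_a (t i == a)%:R * (x (upd t i a) : C)).
    by apply: eq_bigr => a _; rewrite upd_same upd_upd eq_sym.
  by rewrite sum_delta upd_id.
transitivity ((t j == t i)%:R * \sum_a (x (upd (upd t i a) j a) : C));
  last first.
  by rewrite tx ?mulr0 // eq_sym.
rewrite mulr_sumr; apply: eq_bigr => a _.
by rewrite ffunE (negbTE ji).
Qed.

(** The squared lengths of all the [eact a b x] add up to [r] times that of
    [x], while the diagonal ones among them contribute at [t] the factor
    [\sum_a n t a ^ 2], where [n t a] is the multiplicity of [a] in [t].  As
    [r = \sum_a n t a <= \sum_a n t a ^ 2], the two agree on the support of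
    [x], so that no multiplicity there exceeds 1. *)
Lemma harmonic_dinv_inj r (x : tensor C m r)
    (t : ('I_m ^ r)%type) :
  dinv x -> traceless x -> x t != 0 -> injective t.
Proof.
move=> dx tx.
pose n (u : ('I_m ^ r)%type) a := (\sum_i (u i == a))%N.
have sn u : (\sum_a n u a = r)%N.
  rewrite /n exchange_big -[RHS]card_ord -sum1_card; apply: eq_bigr => i _.
  rewrite (bigD1 (u i)) //= eqxx big1 ?addn0 // => a.
  by rewrite eq_sym => /negbTE ->.
have nle u a : (n u a <= n u a ^ 2 ?= iff (n u a <= 1))%N.
  split; first by rewrite -mulnn; case: (n u a) => // k; rewrite leq_pmulr.
  case: (n u a) => [|[|k]] //; apply/negbTE.
  by rewrite -[X in X != _]muln1 -mulnn eqn_pmul2l.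
have nsq u := leqif_sum (fun a (_ : true) => nle u a).
have diag a u : eact a a x u = (n u a)%:R * (x u : C) :> C.
  rewrite eactE natr_sum mulr_suml; apply: eq_bigr => i _.
  by case: eqP => [<-|_]; rewrite ?upd_id ?mul0r.
have total : \sum_a \sum_b \sum_u `|eact a b x u : C| ^+ 2 =
    \sum_u r%:R * `|x u : C| ^+ 2.
  transitivity (\sum_u
      (\sum_a \sum_b (eact b a (eact b a x) u : C)) * (x u : C)^*).
    transitivity (\sum_a \sum_b \sum_u
        (eact b a (eact b a x) u : C) * (x u : C)^*); last first.
      under eq_bigr do rewrite exchange_big; rewrite exchange_big.
      apply: eq_bigr => u _; rewrite mulr_suml; apply: eq_bigr => a _.
      by rewrite mulr_suml.
    apply: eq_bigr => a _; apply: eq_bigr => b _.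
    pose y : tensor C m r := [ffun u => (x u : C)^*].
    transitivity (\sum_u (eact b a (eact b a x) u : C) * y u); last first.
      by apply: eq_bigr => u _; rewrite [y u]ffunE.
    rewrite eact_adj (eactC b a dx); apply: eq_bigr => u _.
    rewrite normCK; congr (_ * _); rewrite !eactE rmorph_sum.
    by apply: eq_bigr => i _; rewrite rmorphM rmorph_nat ffunE.
  by apply: eq_bigr => u _; rewrite eact_casimir // -mulrA -normCK.
have le : \sum_u ((\sum_a n u a ^ 2)%N%:R - r%:R) * `|x u : C| ^+ 2 <= 0.
  under eq_bigr do rewrite mulrBl; rewrite sumrB -total subr_le0.
  apply: (@le_trans _ _ (\sum_a \sum_u `|eact a a x u : C| ^+ 2)).
    rewrite exchange_big; apply: ler_sum => u _; rewrite natr_sum mulr_suml.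
    by apply: ler_sum => a _; rewrite diag normrM normr_nat exprMn natrX.
  apply: ler_sum => a _; rewrite (bigD1 a) //= lerDl.
  by apply: sumr_ge0 => b _; apply: sumr_ge0 => u _; rewrite exprn_ge0.
have ge u : 0 <= ((\sum_a n u a ^ 2)%N%:R - r%:R) * `|x u : C| ^+ 2.
  rewrite mulr_ge0 ?exprn_ge0 // subr_ge0 ler_nat.
  by rewrite -[X in (X <= _)%N](sn u) nsq.
move=> xt.
have : \sum_u ((\sum_a n u a ^ 2)%N%:R - r%:R) * `|x u : C| ^+ 2 = 0.
  by apply/le_anti; rewrite le sumr_ge0.
move/(psumr_eq0P (fun u _ => ge u))/(_ t isT)/eqP.
rewrite mulf_eq0 expf_eq0 normr_eq0 (negbTE xt) andbF orbF subr_eq0 eqr_nat.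
rewrite eq_sym -[X in X == _](sn t) nsq => /forallP nt i j tij.
have := nt (t i); apply: contraTeq => ij; rewrite -ltnNge.
by rewrite /n (bigD1 i) //= (bigD1 j) 1?eq_sym //= tij !eqxx addnA leq_addr.
Qed.

Lemma harmonic_dinv_bij r (x : tensor C m r)
    (t : ('I_m ^ r)%type) :
  dinv x -> traceless x -> x t != 0 -> bijective t.
Proof.
move=> dx tx xt; apply: inj_card_bij; first exact: harmonic_dinv_inj dx tx xt.
rewrite !card_ord -[X in (X <= _)%N]card_ord -[X in (_ <= X)%N]card_ord.
have ex a : {i | t i = a} by apply: cid; apply: dinv_onto dx xt.
apply: (@leq_card _ _ (fun a => sval (ex a))) => a b ab.
by rewrite -(svalP (ex a)) ab (svalP (ex b)).
Qed.

Lemma dinvB r c (x y : tensor C m r) : dinv x -> dinv y -> dinv (x - c *: y).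
Proof.
move=> dx dy g go; rewrite linearB linearZ /= dx // dy //.
by rewrite scalerBr !scalerA mulrC.
Qed.

Lemma tracelessB r c (x y : tensor C m r) :
  traceless x -> traceless y -> traceless (x - c *: y).
Proof.
move=> tx ty i j t ij.
transitivity (\sum_k
    ((x (upd (upd t i k) j k) : C) - c * y (upd (upd t i k) j k))).
  by apply: eq_bigr => k _; rewrite !ffunE.
by rewrite sumrB -mulr_sumr tx // ty // mulr0 subrr.
Qed.

Lemma harmonic_dinv_degree r (x : tensor C m r) :
  dinv x -> traceless x -> x != 0 -> r = m.
Proof.
move=> dx tx /tensor_neq0P[t /(harmonic_dinv_bij dx tx)/bij_eq_card].
by rewrite !card_ord.
Qed.

Lemma bij_perm r (s t : ('I_m ^ r)%type) :
  bijective s -> bijective t -> exists p : 'S_m, t = [ffun i => p (s i)].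
Proof.
move=> [s' sK s'K] bt.
have inj : injective (t \o s') by apply: inj_comp (bij_inj bt) (can_inj s'K).
by exists (perm inj); apply/ffunP => i; rewrite ffunE permE /= sK.
Qed.

(** Any two bijective multi-indices differ by a permutation of the values, and
    permutation matrices are isometries: an element of the support of [y] where
    [x - c *: y] vanishes therefore forces [x = c *: y]. *)
Lemma harmonic_dinv_line r (x y : tensor C m r) :
  dinv x -> traceless x -> dinv y -> traceless y -> y != 0 ->
  exists c, x = c *: y.
Proof.
move=> dx tx dy ty /tensor_neq0P[s ys]; exists ((x s : C) / y s).
set c := _ / _; apply/subr0_eq/eqP/negPn/negP => /tensor_neq0P[t].
have dz := dinvB c dx dy; have tz := tracelessB c tx ty => zt.
have [p tE] :=
  bij_perm (harmonic_dinv_bij dy ty ys) (harmonic_dinv_bij dz tz zt).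
case/eqP: zt; rewrite tE (dinv_perm _ _ dz).
suff -> : (x - c *: y) s = 0 by rewrite mulr0.
by rewrite !ffunE; apply/eqP; rewrite subr_eq0; apply/eqP/esym/divfK.
Qed.

(** Over an algebraically closed field the dot product has isotropic tensors,
    but here all non-zero entries have the same square. *)
Lemma harmonic_dinv_anisotropic r (x : tensor C m r) :
  dinv x -> traceless x -> x != 0 -> \sum_t (x t : C) * x t != 0.
Proof.
move=> dx tx /tensor_neq0P[s xs].
have -> : \sum_t (x t : C) * x t = (\sum_t (x t != 0%R))%N%:R * (x s : C) ^+ 2.
  rewrite natr_sum mulr_suml; apply: eq_bigr => t _.
  have [->|xt] := eqVneq (x t) 0; first by rewrite !mul0r.
  have [p ->] :=
    bij_perm (harmonic_dinv_bij dx tx xs) (harmonic_dinv_bij dx tx xt).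
  by rewrite mul1r (dinv_perm _ _ dx) -expr2 exprMn sqrr_sign mul1r.
rewrite mulf_neq0 ?expf_neq0 // pnatr_eq0 -lt0n (bigD1 s) //= xs.
by rewrite addn_gt0.
Qed.

End Harmonic.

(** * Determinant-invariants of the orthogonal group of the dot product *)

Section Orthogonal.
Variables (C : numClosedFieldType) (m : nat).

Definition ccheck : tensor C m 2 :=
  [ffun s : ('I_m ^ 2)%type => (s 0 == s 1)%:R].

Lemma gact_ccheck (g : 'M[C]_m) (t : ('I_m ^ 2)%type) :
  gact g ccheck t = (g *m g^T) (t 0) (t 1) :> C.
Proof.
rewrite gactE mxE.
rewrite (bigID (fun s : ('I_m ^ 2)%type => s 0 == s 1)) /= addrC big1 ?add0r.
  rewrite (reindex_onto (fun k => [ffun=> k])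
    (fun s : ('I_m ^ 2)%type => s 0)) /=.
    apply: eq_big => [k|k _]; first by rewrite !ffunE !eqxx.
    rewrite !ffunE eqxx mul1r big_ord_recl big_ord1 !ffunE mxE.
    by congr (_ * g (t _) _); apply: val_inj.
  move=> s /eqP s01; apply/ffunP => i; rewrite ffunE.
  by case: i => [[|[|//]]] lti; [|rewrite s01]; congr (s _); apply: val_inj.
by move=> s /negbTE s01; rewrite ffunE s01 mul0r.
Qed.

Lemma gact_ccheck_orth (g : 'M[C]_m) :
  g^T *m g = 1%:M -> gact g ccheck = ccheck.
Proof.
by move=> /mulmx1C go; apply/ffunP => t; rewrite gact_ccheck go mxE ffunE.
Qed.

Lemma ccheck_neq0 : (0 < m)%N -> ccheck != 0.
Proof.
move=> m0; apply/tensor_neq0P; exists [ffun=> Ordinal m0].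
by rewrite !ffunE eqxx oner_neq0.
Qed.

Lemma tpow_neq0 r k (x : tensor C m r) : x != 0 -> tpow x k != 0.
Proof.
move=> x0; elim: k => [|k IHk]; last exact: tmul_neq0.
apply/tensor_neq0P; exists [ffun i : 'I_0 => match notF (ltn_ord i) with end].
by rewrite ffunE big_ord0 oner_neq0.
Qed.

Lemma permuted_neq0 r s (x : tensor C m r) (y : tensor C m s) :
  permuted x y -> x != 0 -> y != 0.
Proof.
move=> /permuted_sym[f [_ fE]] /tensor_neq0P[t xt].
by apply/tensor_neq0P; eexists; move: xt; rewrite fE; apply.
Qed.

Lemma dinv_permuted r s (x : tensor C m r) (y : tensor C m s) :
  permuted x y -> dinv x -> dinv y.
Proof.
move=> [f [bf fE]] dx g go; apply/ffunP => t.
by rewrite (gact_permuted g bf fE) dx // tensorZE tensorZE fE.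
Qed.

Lemma dinv_tmul_ccheck r k (x : tensor C m r) :
  dinv x -> dinv (tmul x (tpow ccheck k)).
Proof.
move=> dx g go; rewrite gact_tmul gact_tpow gact_ccheck_orth // dx //.
by apply/ffunP => t; rewrite tensorZE !tmul_entry tensorZE mulrA.
Qed.

Definition ctr r (x : tensor C m (2 + r)) : tensor C m r := mxcontract 1%:M x.

Definition cons2 r (c : 'I_m) (t : ('I_m ^ r)%type) : ('I_m ^ (2 + r))%type :=
  [ffun i => match split i with inl _ => c | inr b => t b end].

Lemma ctrE r (x : tensor C m (2 + r)) t :
  ctr x t = \sum_c (x (cons2 c t) : C) :> C.
Proof.
rewrite ffunE; apply: eq_bigr => c _; rewrite (bigD1 c) //= mxE eqxx mulr1 big1.
  rewrite addr0; congr (x _); apply/ffunP => i; rewrite !ffunE.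
  by case: split => // a; case: ifP.
by move=> k; rewrite mxE eq_sym => /negbTE ->; rewrite mulr0.
Qed.

Lemma dinv_ctr r (x : tensor C m (2 + r)) : dinv x -> dinv (ctr x).
Proof.
move=> dx g go; have := mxcontract_gact 1%:M g x.
rewrite mulmx1 go dx // => <-; apply/ffunP => t.
rewrite tensorZE -/(ctr _) !ctrE mulr_sumr; apply: eq_bigr => c _.
exact: tensorZE.
Qed.

Definition dot r (x y : tensor C m r) : C := \sum_t (x t : C) * y t.

Lemma dot_ctr r (x : tensor C m (2 + r)) (y : tensor C m r) :
  dot (ctr x) y = dot x (tmul ccheck y).
Proof.
rewrite /dot; under eq_bigr do rewrite ctrE mulr_suml.
rewrite pair_big /=.
have sel (s : ('I_m ^ (2 + r))%type) :
    cons2 (s (lshift r 0)) [ffun i => s (rshift 2 i)] = s <->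
    s (lshift r 0) = s (lshift r 1).
  split=> [<-|s01]; first by rewrite !ffunE !(unsplitK (inl _)).
  apply/ffunP => i; rewrite ffunE -[in RHS](splitK i).
  case: (split i) => a /=; last by rewrite ffunE.
  by case: a => [[|[|//]]] lta; [|rewrite s01]; congr (s _); apply: val_inj.
rewrite [RHS](bigID (fun s : ('I_m ^ (2 + r))%type =>
  s (lshift r 0) == s (lshift r 1))) /=.
rewrite [X in _ = _ + X]big1 ?addr0 => [|s /negbTE s01]; last first.
  by rewrite tmul_entry !ffunE s01 mul0r mulr0.
rewrite (reindex_onto (fun p : ('I_m ^ r)%type * 'I_m => cons2 p.2 p.1)
  (fun s => ([ffun i => s (rshift 2 i)], s (lshift r 0)))) /=; last first.
  by move=> s /eqP/sel.
apply: eq_big => [[t c]|[t c] _] /=.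
  rewrite !ffunE !(unsplitK (inl _)) eqxx; apply/esym/eqP; congr (_, _).
  by apply/ffunP => i; rewrite !ffunE (unsplitK (inr _)).
rewrite tmul_entry !ffunE !(unsplitK (inl _)) eqxx mul1r; congr (_ * y _).
by apply/ffunP => i; rewrite !ffunE (unsplitK (inr _)).
Qed.

Lemma dot_symact r (p : 'S_r) (x y : tensor C m r) :
  dot (symact p x) y = dot x (symact (p^-1)%g y).
Proof.
rewrite /dot.
rewrite (reindex (fun t : ('I_m ^ r)%type => [ffun i => t ((p^-1)%g i)])) /=.
  apply: eq_bigr => t _; rewrite !symact_entry; congr (x _ * _).
  by apply/ffunP => i; rewrite !ffunE permK.
exists (fun t : ('I_m ^ r)%type => [ffun i => t (p i)]) => t _;
  by apply/ffunP => i; rewrite !ffunE ?permK ?permKV.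
Qed.

Lemma ctr_traceless r (x : tensor C m (2 + r)) :
  (forall p, ctr (symact p x) = 0) -> traceless x.
Proof.
move=> hx i j t ij.
pose i0 := lshift r 0 : 'I_(2 + r); pose i1 := lshift r 1 : 'I_(2 + r).
(* The permutation bringing the factors i and j in the first two places. *)
pose p := (tperm i i0 * tperm (tperm i i0 j) i1)%g.
have pj : p j = i1 by rewrite permM tpermL.
have pi : p i = i0.
  rewrite permM tpermL tpermD //.
  by rewrite -[X in _ != X](tpermL i i0) (inj_eq perm_inj) eq_sym.
have z0 : ctr (symact p x) [ffun b => t ((p^-1)%g (rshift 2 b))] = 0 :> C.
  by rewrite hx ffunE.
rewrite -[RHS]z0 ctrE; apply: eq_bigr => c _.
rewrite symact_entry; congr (x _); apply/ffunP => k; rewrite !ffunE.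
have [->|kj] := eqVneq k j; first by rewrite pj (unsplitK (inl _)).
have [->|ki] := eqVneq k i; first by rewrite pi (unsplitK (inl _)).
have := splitK (p k); case: (split (p k)) => a /= pk; last first.
  by rewrite ffunE pk permK.
suff : (p k == i0) || (p k == i1).
  by rewrite -pi -pj !(inj_eq perm_inj) (negbTE ki) (negbTE kj).
rewrite -pk; case: a {pk} => [[|[|//]]] lta; apply/orP; [left|right];
  by apply/eqP/val_inj.
Qed.

Lemma permuted_tmul1 r (x : tensor C m r) (v : 'I_0 -> 'cV[C]_m) :
  permuted (tmul x (pure v)) x.
Proof.
exists (cast_ord (addn0 r)); split=> [|t].
  by exists (cast_ord (esym (addn0 r))) => i; apply: val_inj.
rewrite tmul_entry [pure v _]ffunE big_ord0 mulr1; congr (x _).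
by apply/ffunP => i; rewrite !ffunE; congr (t _); apply: val_inj.
Qed.

Section Generator.
Variables (rc : nat) (Lambda : tensor C m rc).
Hypotheses (dL : dinv Lambda) (tL : traceless Lambda) (nzL : Lambda != 0).

Notation gen k := (tmul Lambda (tpow ccheck k)).

Lemma permuted_gen k r (z : tensor C m r) : permuted (gen k) z ->
  permuted (gen k.+1) (tmul ccheck z).
Proof.
move=> gz; refine (permuted_trans _ (permuted_tmul (permuted_refl ccheck) gz)).
refine (permuted_trans _ (permuted_tmulA ccheck Lambda (tpow ccheck k))).
refine (permuted_trans (permuted_sym
  (permuted_tmulA Lambda ccheck (tpow ccheck k))) _).
exact: permuted_tmul (permuted_tmulC _ _) (permuted_refl _).
Qed.

(** Contraction is adjoint to the insertion of [ccheck], so the contractions of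
    [x] inherit the orthogonality and vanish by induction; this leaves the
    multiples of [Lambda], where [k = 0] applies. *)
Lemma dinv_orthogonal_eq0 r (x : tensor C m r) : dinv x ->
  (forall k (z : tensor C m r), permuted (gen k) z -> dot x z = 0) -> x = 0.
Proof.
elim/ltn_ind: r x => r IHr x dx ox.
have tx : traceless x.
  case: r IHr x dx ox => [|[|r]] IHr x dx ox.
  - by case.
  - by move=> i j t; rewrite !ord1 eqxx.
  apply: ctr_traceless => p; apply: IHr => //.
    exact: dinv_ctr (dinv_permuted (permuted_symact p x) dx).
  move=> k z gz; rewrite dot_ctr dot_symact; apply: (ox k.+1).
  exact: permuted_trans (permuted_gen gz) (permuted_symact _ _).
apply/eqP/negPn/negP => nx.
have e : rc = r.
  by rewrite (harmonic_dinv_degree dL tL nzL) (harmonic_dinv_degree dx tx nx).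
case: r / e x dx ox tx nx {IHr} => x dx ox tx nx.
have [c xE] := harmonic_dinv_line dx tx dL tL nzL.
have := ox 0 Lambda (permuted_tmul1 _ _); rewrite xE /dot.
under eq_bigr do rewrite tensorZE -mulrA.
rewrite -mulr_sumr => /eqP; rewrite mulf_eq0.
rewrite (negbTE (harmonic_dinv_anisotropic dL tL nzL)) orbF => /eqP c0.
by move: nx; rewrite xE c0 scale0r eqxx.
Qed.

Definition dotcoord r n (b : n.-tuple (tensor C m r)) (x : tensor C m r) :
    'rV[C]_n :=
  \row_i dot x (tnth b i).

Lemma dotcoord_is_linear r n (b : n.-tuple (tensor C m r)) :
  linear (dotcoord b).
Proof.
move=> a x y; apply/rowP => i; rewrite !mxE /dot mulr_sumr -big_split /=.
by apply: eq_bigr => t _; rewrite ffunE tensorZE mulrDl mulrA.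
Qed.

HB.instance Definition _ r n (b : n.-tuple (tensor C m r)) :=
  GRing.isLinear.Build C (tensor C m r) 'rV[C]_n _ (dotcoord b)
    (dotcoord_is_linear b).

(** The functionals [dot _ z] with [z] in [S] separate the points of
    [S + <[x]>], hence the dimension of the latter is at most that of [S]. *)
Lemma separated_mem r (S : {vspace tensor C m r}) x :
  (forall y, y \in (S + <[x]>)%VS ->
    (forall z, z \in S -> dot y z = 0) -> y = 0) ->
  x \in S.
Proof.
move=> sep; set U := (S + <[x]>)%VS in sep.
pose f := linfun (dotcoord (vbasis S)).
have kerf : (U :&: lker f)%VS = 0%VS.
  apply/eqP; rewrite -subv0; apply/subvP => y /memv_capP[yU].
  rewrite memv_ker lfunE /= memv0 => /eqP/rowP fy; apply/eqP/sep => // z zS.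
  have /coord_vbasis-> := zS.
  rewrite /dot; under eq_bigr do rewrite sum_ffunE mulr_sumr.
  rewrite exchange_big big1 // => i _.
  under eq_bigr do rewrite tensorZE mulrCA.
  rewrite -mulr_sumr; have := fy i; rewrite !mxE /dot (tnth_nth 0) => ->.
  by rewrite mulr0.
have leU : (\dim U <= \dim S)%N.
  rewrite -(limg_ker_dim f U) kerf dimv0 add0n.
  by apply: leq_trans (dimvS (subvf _)) _; rewrite dimvf /dim /= mul1n.
have /eqP -> : (S == U)%VS by rewrite eqEdim addvSl.
exact: (subvP (addvSr S _)) _ (memv_line x).
Qed.

Lemma dinv_sym_span r k (e : (rc + k * 2)%N = r) (x : tensor C m r) :
  dinv x <-> x \in sym_span (tensor_cast e (gen k)).
Proof.
set S := sym_span _.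
have memS z : permuted (gen k) z -> z \in S.
  move=> gz; have /permutedP[p ->] : permuted (tensor_cast e (gen k)) z.
    exact: permuted_trans (permuted_sym (permuted_cast _ _)) gz.
  by apply: memv_span; apply/mapP; exists p; rewrite ?mem_enum.
have Sd y : y \in S -> dinv y.
  rewrite /S /sym_span => /(@coord_span _ _ _ (in_tuple _)) -> g go.
  rewrite linear_sum scaler_sumr; apply: eq_bigr => i _.
  rewrite linearZ /= scalerA mulrC -scalerA; congr (_ *: _).
  have /mapP[p _ ->] := mem_nth 0 (ltn_ord i).
  have dp : dinv (symact p (tensor_cast e (gen k))).
    apply: dinv_permuted (permuted_symact _ _) _.
    exact: dinv_permuted (permuted_cast _ _) (dinv_tmul_ccheck _ dL).
  exact: dp.
split=> [dx|]; last exact: Sd.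
apply: separated_mem => y /memv_addP[s sS [_ /vlineP[c ->] ->]] oy.
apply: dinv_orthogonal_eq0 => [|k' z gz].
  rewrite -[c]opprK scaleNr; exact: dinvB (Sd s sS) dx.
apply/oy/memS.
suff -> : k = k' by [].
by apply/eqP; rewrite -(@eqn_pmul2r 2) // -(eqn_add2l rc) (permuted_size gz) e.
Qed.

End Generator.
End Orthogonal.

(** * Change of basis *)

Section Transfer.
Variables (C : numClosedFieldType) (m : nat) (B : {symmetric 'cV[C]_m}).

Definition gram : 'M[C]_m := \matrix_(i, j) B (delta_mx i 0) (delta_mx j 0).

Lemma gramP (u v : 'cV[C]_m) : B u v = (u^T *m gram *m v) 0 0.
Proof.
rewrite [u in LHS]col_delta_sum linear_sumlz mxE.
under [RHS]eq_bigr do rewrite mxE mulr_suml.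
rewrite exchange_big; apply: eq_bigr => i _.
rewrite linearZl_LR /= [v in LHS]col_delta_sum linear_sumr mulr_sumr.
by apply: eq_bigr => j _; rewrite linearZr_LR !mxE /= mulrCA mulrC.
Qed.

Lemma contract_gram r (x : tensor C m (2 + r)) :
  contract B x = mxcontract gram x.
Proof.
apply/ffunP => t; rewrite contractE !ffunE.
by apply: eq_bigr => j _; apply: eq_bigr => k _; rewrite mxE.
Qed.

Lemma delta_entry (A : 'M[C]_m) i j :
  ((delta_mx i 0 : 'cV[C]_m)^T *m A *m (delta_mx j 0 : 'cV[C]_m)) 0 0 = A i j.
Proof. by rewrite trmx_delta -rowE -colE !mxE. Qed.

Lemma isometry_gram (g : 'M[C]_m) :
  isometry B B (mulmx g) <-> g^T *m gram *m g = gram.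
Proof.
split=> [iso|gB u v]; last by rewrite !gramP trmx_mul -{2}gB !mulmxA.
apply/matrixP => i j; have := iso (delta_mx i 0) (delta_mx j 0).
rewrite !gramP trmx_mul => e.
by rewrite -[LHS]delta_entry -[RHS]delta_entry -e !mulmxA.
Qed.

Lemma orthonormal_nth (s : seq 'cV[C]_m) i j : orthonormal B s ->
  (i < size s)%N -> (j < size s)%N -> B s`_i s`_j = (i == j)%:R.
Proof.
elim: s i j => // u s IHs i j; rewrite /orthonormal /=.
case/andP=> /andP[/eqP uu s1] /andP[/ortho_rec1P us os].
have mem k : (k < size s)%N -> s`_k \in <<s>>%VS.
  by move=> ks; rewrite memv_span ?mem_nth.
case: i j => [|i] [|j] //= ilt jlt.
- by rewrite us ?mem.
- by rewrite symform_sym us ?mem.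
- by apply: IHs => //; rewrite /orthonormal s1.
Qed.

Variable e : m.-tuple 'cV[C]_m.
Hypothesis eB : orthonormal_basis B e.

Definition basis_mx : 'M[C]_m := \matrix_(i, j) tnth e j i 0.
Notation E := basis_mx.

Lemma basis_mx_gram : E^T *m gram *m E = 1%:M.
Proof.
have colE' j : E *m (delta_mx j 0 : 'cV_m) = tnth e j.
  by rewrite -colE; apply/colP => i; rewrite !mxE.
apply/matrixP => i j.
have -> : (E^T *m gram *m E) i j = B (tnth e i) (tnth e j).
  by rewrite -!colE' gramP trmx_mul -[LHS]delta_entry !mulmxA.
have /andP[_ oe] := eB.
by rewrite !(tnth_nth 0) orthonormal_nth ?size_tuple // mxE.
Qed.

Lemma basis_mx_unit : E \in unitmx.
Proof. by case/mulmx1_unit: basis_mx_gram. Qed.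

Notation E' := (invmx E).

Lemma gram_basis_mx : E'^T *m E' = gram.
Proof.
rewrite -[E'^T]mulmx1 -basis_mx_gram !mulmxA -trmx_mul mulmxV ?basis_mx_unit //.
by rewrite trmx1 mul1mx -mulmxA mulmxV ?basis_mx_unit // mulmx1.
Qed.

Lemma gact_basisK r : cancel (@Defs.gact C m r E) (gact E').
Proof. by move=> x; rewrite gact_mul mulVmx ?basis_mx_unit // gact1. Qed.

Lemma gact_basisVK r : cancel (@Defs.gact C m r E') (gact E).
Proof. by move=> x; rewrite gact_mul mulmxV ?basis_mx_unit // gact1. Qed.

Lemma checkC_basis : checkC e = gact E (ccheck C m).
Proof.
apply/ffunP => t; rewrite gact_ccheck sum_ffunE mxE; apply: eq_bigr => i _.
rewrite ffunE big_ord_recl big_ord1 !mxE; congr (_ * tnth e i (t _) 0).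
exact: val_inj.
Qed.

(** Conjugation by the basis matrix is a determinant-preserving bijection from
    the isometries of the dot product to those of the form. *)
Lemma det_invariants_basis r (x : tensor C m r) :
  det_invariants B r x <-> dinv (gact E' x).
Proof.
have uE := basis_mx_unit; split=> [dx h ho|dx g /isometry_gram gB].
  pose g := E *m h *m E'.
  have E'g : E' *m g = h *m E' by rewrite /g !mulmxA mulVmx // mul1mx.
  have dg : \det g = \det h.
    by rewrite !det_mulmx mulrAC -det_mulmx mulmxV // det1 mul1r.
  clearbody g; have gB : isometry B B (mulmx g).
    apply/isometry_gram; rewrite -gram_basis_mx !mulmxA -trmx_mul -mulmxA E'g.
    by rewrite trmx_mul mulmxA -[E'^T *m _ *m h]mulmxA ho mulmx1.
  have := congr1 (gact E') (dx g gB).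
  by rewrite linearZ !gact_mul E'g dg.
pose h := E' *m g *m E.
have Eh : E *m h = g *m E by rewrite /h !mulmxA mulmxV // mul1mx.
have dh : \det h = \det g.
  by rewrite !det_mulmx mulrAC -det_mulmx mulVmx // det1 mul1r.
clearbody h; have ho : h^T *m h = 1%:M.
  rewrite -[h^T]mulmx1 -[in LHS]basis_mx_gram !mulmxA -trmx_mul -mulmxA Eh.
  by rewrite trmx_mul -[RHS]basis_mx_gram -[in RHS]gB !mulmxA.
have := congr1 (gact E) (dx h ho); rewrite dh linearZ /= gact_basisVK => <-.
by rewrite !gact_mul Eh -mulmxA mulmxV // mulmx1.
Qed.

Lemma harmonic_basis r (x : tensor C m r) :
  harmonic B x -> traceless (gact E' x).
Proof.
case: r x => [|[|r]] x.
- by move=> _ [].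
- by move=> _ i j t; rewrite !ord1 eqxx.
move=> hx; apply: ctr_traceless => p.
rewrite /ctr -gact_symact (mxcontract_gact 1%:M) mulmx1 gram_basis_mx.
by rewrite -contract_gram hx linear0.
Qed.

Lemma gact_sym_span r (g : 'M[C]_m) (x y : tensor C m r) :
  y \in sym_span x -> gact g y \in sym_span (gact g x).
Proof.
rewrite /sym_span => /(@coord_span _ _ _ (in_tuple _)) ->.
rewrite linear_sum memv_suml // => i _; rewrite linearZ /= memvZ //.
have /mapP[p _ ->] := mem_nth 0 (ltn_ord i).
by rewrite gact_symact memv_span //; apply/mapP; exists p; rewrite ?mem_enum.
Qed.

End Transfer.

Local Open Scope complex_scope.

Theorem theorem2p1 (R : realType) (m : nat) (B : {symmetric 'cV[R[i]]_m})
    (ndB : nondegenerate B) (rc : nat) (rc_gt0 : (0 < rc)%N)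
    (Lambda : tensor R[i] m rc) (harmL : harmonic B Lambda)
    (detL : det_invariants B rc Lambda) (normL : tform B Lambda Lambda != 0)
    (r : nat) :
  (det_invariants B r <> [set 0] <-> (rc <= r)%N /\ ~~ odd (r - rc)) /\
  (forall (ler : (rc <= r)%N) (evr : ~~ odd (r - rc))
     (e : m.-tuple 'cV[R[i]]_m), orthonormal_basis B e ->
     det_invariants B r =
     [set` sym_span (tensor_cast (sub_half_mul2 ler evr)
                       (tmul Lambda (tpow (checkC e) (r - rc)./2)))]).
Proof.
have nzL : Lambda != 0.
  apply: contraNneq normL => ->; rewrite /tform /tlin big1 // => s _.
  by rewrite ffunE scale0r.
have nzV e : orthonormal_basis B e -> gact (invmx (basis_mx e)) Lambda != 0.
  move=> eB; apply: contraNneq nzL => L0.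
  by rewrite -(gact_basisVK eB Lambda) L0 linear0.
split; last first.
  move=> ler evr e eB; set k := _./2; set er := sub_half_mul2 _ _.
  have L' := (det_invariants_basis eB Lambda).1 detL.
  have T' := harmonic_basis eB harmL.
  have span := dinv_sym_span L' T' (nzV e eB) er.
  have genE : gact (basis_mx e) (tensor_cast er
      (tmul (gact (invmx (basis_mx e)) Lambda) (tpow (ccheck R[i] m) k))) =
      tensor_cast er (tmul Lambda (tpow (checkC e) k)).
    by rewrite gact_cast gact_tmul gact_tpow (gact_basisVK eB) -checkC_basis.
  apply/seteqP; split=> x /=.
    move/(det_invariants_basis eB)/span/(gact_sym_span (basis_mx e)).
    by rewrite genE (gact_basisVK eB).
  rewrite -genE => /(gact_sym_span (invmx (basis_mx e))).
  by rewrite (gact_basisK eB) => /span/(det_invariants_basis eB).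
have [e eB] := orthonormal_basis_exists ndB.
have L' := (det_invariants_basis eB Lambda).1 detL.
have T' := harmonic_basis eB harmL.
split=> [nz|[ler evr] z].
  suff [k <-] : exists k, (rc + k * 2)%N = r.
    by rewrite leq_addr addKn muln2 odd_double.
  apply: contra_notP nz => nk; apply/seteqP; split=> x /=; last first.
    by move=> -> g _; rewrite linear0 scaler0.
  move/(det_invariants_basis eB) => dx; rewrite -(gact_basisVK eB x).
  rewrite (dinv_orthogonal_eq0 L' T' (nzV e eB) dx) ?linear0 // => k y py.
  by case: nk; exists k; apply: permuted_size py.
have er := sub_half_mul2 ler evr.
set y := tmul (gact (invmx (basis_mx e)) Lambda)
  (tpow (ccheck R[i] m) (r - rc)./2).
have dy : dinv (tensor_cast er y).
  exact: dinv_permuted (permuted_cast er y) (dinv_tmul_ccheck _ L').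
have ny : tensor_cast er y != 0.
  apply: permuted_neq0 (permuted_cast er y) _.
  apply: tmul_neq0 (nzV e eB) (tpow_neq0 _ _).
  apply: ccheck_neq0; have /tensor_neq0P[t _] := nzL.
  exact: leq_ltn_trans (leq0n _) (ltn_ord (t (Ordinal rc_gt0))).
have : det_invariants B r (gact (basis_mx e) (tensor_cast er y)).
  by apply/(det_invariants_basis eB); rewrite (gact_basisK eB).
rewrite z /= => /(congr1 (gact (invmx (basis_mx e)))).
rewrite (gact_basisK eB) linear0 => y0.
by rewrite y0 eqxx in ny.
Qed.
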